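(* Let $$W:=\bigcup_{m=0}^{3}\mathrm{i}^m\left(W_1\cup W_2\cup(\mathrm{e}^{\mathrm{i}\pi/6}+\eta\mathbb{D})\cup(\mathrm{e}^{-\mathrm{i}\pi/6}+\eta\mathbb{D})\right).$$ Then $1.1\,\overline{\mathbb{D}}\subset W\subset\operatorname{int}(\Sigma_\pi)$.
   Context: For $c\in\{\pm1\}^{\mathbb{Z}}$ let $A_c$ be the bounded operator on $\ell^2(\mathbb{Z})$ given by $(A_c\phi)_m=c_m\phi_{m-1}+\phi_{m+1}$, $m\in\mathbb{Z}$. $\pi_\infty$ is the union of the spectra (on $\ell^2(\mathbb{Z})$) of $A_c$ over all periodic $c\in\{\pm1\}^{\mathbb{Z}}$, and $\Sigma_\pi:=\overline{\pi_\infty}\subset\mathbb{C}$. $\operatorname{int}$ denotes interior in $\mathbb{C}$; $\mathbb{D}:=\{\lambda\in\mathbb{C}:|\lambda|<1\}$. For $-1\le t\le1$, $s(t)>0$ is the largest positive solution $s$ of $s^3-2ts^2+s=1$. For $\theta\in\mathbb{R}$, $S(\theta):=\sqrt{s(\cos2\theta)}$. $W_1:=\{r\mathrm{e}^{\mathrm{i}\theta}:0\le r<S(\theta),\ -\pi/6\le\theta\le\pi/6\}$. $W_2:=\{r\mathrm{e}^{\mathrm{i}\theta}:0\le r<\sqrt{S(2\theta-\pi/2)},\ \pi/6\le\theta\le\pi/3\}$. $\eta\approx0.174744$ is the unique positive solution $\epsilon$ of $\epsilon(1+\epsilon)^2(\sqrt3+\epsilon)(2+\epsilon)=1$. *)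

(* Defs.v *)
From mathcomp Require Import all_boot all_order all_algebra.
From mathcomp Require Import all_classical all_reals all_analysis.
From mathcomp Require Import complex polyrcf ring lra.
Set Implicit Arguments.
Unset Strict Implicit.
Unset Printing Implicit Defensive.
Import Order.TTheory GRing.Theory Num.Theory.
Import numFieldNormedType.Exports.
Local Open Scope classical_set_scope.
Local Open Scope complex_scope.
Local Open Scope ring_scope.

(* Subsets of the complex plane have type set R[i]^o: the regular alias of
   R[i] is the one carrying the topology given by the modulus.
   Normc.normc is the modulus with values in R, while `|z| is in R[i]. *)

Definition in_l2 (R : realType) (phi : int -> R[i]) : Prop :=
  summable [set: int] (fun m => ((Normc.normc (phi m)) ^+ 2)%:E).

Definition l2norm (R : realType) (phi : int -> R[i]) : R :=
  Num.sqrt (fine (\esum_(m in [set: int]) ((Normc.normc (phi m)) ^+ 2)%:E)).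

(* Operators on l^2(Z) are maps on all sequences, of which only the values on
   square-summable sequences matter. *)
Definition bounded_operator (R : realType)
    (T : (int -> R[i]) -> int -> R[i]) : Prop :=
  [/\ forall phi, in_l2 phi -> in_l2 (T phi),
      forall (a : R[i]) phi psi, in_l2 phi -> in_l2 psi ->
        forall m, T (fun k => a * phi k + psi k) m = a * T phi m + T psi m
    & exists M : R, forall phi, in_l2 phi -> l2norm (T phi) <= M * l2norm phi].

Definition shifted (R : realType) (T : (int -> R[i]) -> int -> R[i])
    (lambda : R[i]) : (int -> R[i]) -> int -> R[i] :=
  fun phi m => T phi m - lambda * phi m.

Definition spectrum (R : realType) (T : (int -> R[i]) -> int -> R[i]) :
    set R[i]^o :=
  [set lambda | ~ exists B : (int -> R[i]) -> int -> R[i],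
    bounded_operator B /\
    forall phi, in_l2 phi ->
      (forall m, B (shifted T lambda phi) m = phi m) /\
      (forall m, shifted T lambda (B phi) m = phi m)].

Definition hopping (R : realType) (c : int -> R[i]) (phi : int -> R[i])
    (m : int) : R[i] :=
  c m * phi (m - 1) + phi (m + 1).

Definition pm1 (R : realType) (c : int -> R[i]) : Prop :=
  forall m, c m = 1 \/ c m = -1.

Definition periodic (R : realType) (c : int -> R[i]) : Prop :=
  exists2 n : nat, (0 < n)%N & forall m : int, c (m + n%:Z) = c m.

Definition pi_infty (R : realType) : set R[i]^o :=
  [set lambda | exists c : int -> R[i],
    [/\ pm1 c, periodic c & spectrum (hopping c) lambda]].

Definition Sigma_pi (R : realType) : set R[i]^o := closure (@pi_infty R).

Definition unit_disc (R : realType) : set R[i]^o :=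
  [set z | Normc.normc z < 1].

Definition expi (R : realType) (theta : R) : R[i] := cos theta +i* sin theta.

Definition is_s (R : realType) (t x : R) : Prop :=
  [/\ 0 < x, x ^+ 3 - 2 * t * x ^+ 2 + x = 1 &
      forall y : R, 0 < y -> y ^+ 3 - 2 * t * y ^+ 2 + y = 1 -> y <= x].

Definition sfun (R : realType) (t : R) : R := xget 0 [set x | is_s t x].

Lemma sfunP (R : realType) (t : R) : is_s t (sfun t).
Proof.
rewrite /sfun; apply: (@xgetPex R 0 [set x | is_s t x]) => /=.
pose q : {poly R} := 'X^3 - (2 * t) *: 'X^2 + 'X - 1%:P.
have qE x : q.[x] = x ^+ 3 - 2 * t * x ^+ 2 + x - 1 by rewrite /q !hornerE.
have q0 : q != 0.
  by apply/eqP => q0; move: (qE 0); rewrite q0 horner0 => /esym; lra.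
have rq x : (x \in rootsR q) = (q.[x] == 0).
  by have /roots_onP/(_ x) := roots_on_rootsR q0; rewrite inE /= => <-.
have [x0 /andP[x0_ge0 _] /eqP x0_root] :
    exists2 x, 0 <= x <= 1 + `|2 * t| & root q x.
  apply: poly_ivt; first by have := normr_ge0 (2 * t); lra.
  rewrite !qE; have := normr_ge0 (2 * t); have := ler_norm (2 * t).
  by set a := `|_|; set b := 2 * t => ba a0; nra.
have x0_gt0 : 0 < x0.
  rewrite lt_neqAle x0_ge0 andbT; apply/eqP => x00.
  by move: x0_root; rewrite qE -x00; lra.
pose M := \big[Num.max/x0]_(x <- rootsR q | x0 <= x) x.
have [Mr Mx0] : q.[M] = 0 /\ x0 <= M.
  rewrite /M big_seq_cond.
  apply: (big_ind (fun z => q.[z] = 0 /\ x0 <= z)) => //.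
  - by move=> x y ? ?; rewrite /Num.max; case: ifP.
  - by move=> x /andP[]; rewrite rq => /eqP.
exists M; split; first exact: lt_le_trans Mx0.
- by move: Mr; rewrite qE => ?; lra.
- move=> y y_gt0 y_root; have [yx0|x0y] := leP y x0.
    exact: le_trans Mx0.
  apply: (@Order.TotalTheory.le_bigmax_seq _ R R (rootsR q) x0 y (fun x => x0 <= x) id) => //; last exact: ltW.
  by rewrite rq qE; apply/eqP; lra.
Qed.

Definition is_eta (R : realType) (e : R) : Prop :=
  0 < e /\ e * (1 + e) ^+ 2 * (Num.sqrt 3 + e) * (2 + e) = 1.

Definition eta (R : realType) : R := xget 0 [set e | is_eta e].

Lemma etaP (R : realType) : is_eta (eta R).
Proof.
rewrite /eta; apply: (@xgetPex R 0 [set e | is_eta e]) => /=.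
pose w : R := Num.sqrt 3.
have w_ge0 : 0 <= w by rewrite sqrtr_ge0.
pose q : {poly R} := 'X * (1 + 'X) ^+ 2 * (w%:P + 'X) * (2%:P + 'X) - 1%:P.
have qE x : q.[x] = x * (1 + x) ^+ 2 * (w + x) * (2 + x) - 1.
  by rewrite /q !hornerE.
have [x /andP[x_ge0 _] /eqP] : exists2 x, 0 <= x <= 1 & root q x.
  by apply: poly_ivt; rewrite // !qE; apply/andP; split; nra.
rewrite qE => xq; exists x; split; last by rewrite -/w; lra.
by rewrite lt_neqAle x_ge0 andbT; apply/eqP => x0; move: xq; rewrite -x0; lra.
Qed.

Lemma eta_unique (R : realType) (e : R) : is_eta e -> e = eta R.
Proof.
suff le_uniq (x y : R) : is_eta x -> is_eta y -> x <= y.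
  by move=> he; apply/eqP; rewrite eq_le !le_uniq //; exact: etaP.
move=> [x0 hx] [y0 hy]; rewrite leNgt; apply/negP => yx.
have w_ge0 : 0 <= Num.sqrt 3 :> R by rewrite sqrtr_ge0.
have [y_ge0 y1_ge0 y2_ge0] : [/\ 0 <= y, 0 <= 1 + y & 0 <= 2 + y].
  by split; lra.
have yw_ge0 : 0 <= Num.sqrt 3 + y by exact: addr_ge0.
suff : y * (1 + y) ^+ 2 * (Num.sqrt 3 + y) * (2 + y) <
       x * (1 + x) ^+ 2 * (Num.sqrt 3 + x) * (2 + x) by rewrite hx hy ltxx.
by do !apply: ltr_pM; rewrite ?ltrXn2r ?ltrD2l ?mulr_ge0 ?exprn_ge0.
Qed.

Definition Sfun (R : realType) (theta : R) : R :=
  Num.sqrt (sfun (cos (2 * theta))).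

Definition W1 (R : realType) : set R[i]^o :=
  [set z | exists r theta : R,
    [/\ 0 <= r < Sfun theta, - (pi / 6) <= theta <= pi / 6
      & z = r%:C * expi theta]].

Definition W2 (R : realType) : set R[i]^o :=
  [set z | exists r theta : R,
    [/\ 0 <= r < Num.sqrt (Sfun (2 * theta - pi / 2)), pi / 6 <= theta <= pi / 3
      & z = r%:C * expi theta]].

Definition eta_disc (R : realType) (a : R[i]) : set R[i]^o :=
  [set a + (eta R)%:C * z | z in @unit_disc R].

Definition W (R : realType) : set R[i]^o :=
  \bigcup_(m in [set m : nat | (m <= 3)%N])
    [set 'i%C ^+ m * z | z in @W1 R `|` @W2 R `|` @eta_disc R (expi (pi / 6))
                             `|` @eta_disc R (expi (- (pi / 6)))].

(* Main.v *)
(* A nonzero Bloch wave (a solution of [A_c phi = w phi] that a period multiplies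
   by a number of modulus 1) puts [w] into [pi_infty].  For each of
   [p = X^2, X^3 - X, X^5 - X^3 + X], a Bloch wave with eigenvalue [p l != 0] on
   the sublattice [n Z], [n] the degree of [p], extends to one with eigenvalue [l]
   on [Z] for other coefficients [c].  Taking square roots repeatedly from [0, 2]
   shows that Bloch eigenvalues are dense in the unit disc; since the roots of a
   monic polynomial depend continuously on its constant term, the closure then
   contains every [l] with [|p l| < 1].  The sets [W1], [W2] and the discs of
   radius [eta] lie in such open sets for [p = X^3 - X], for [X^6 + X^2] (the cubic
   composed with [- i X^2]) and for the quintic, whose nonzero roots are
   [+- e^(+- i pi/6)].  The first inclusion is a numerical estimate near the
   corners [e^(+- i pi/6)] and their rotations. *)
Require Import Defs.
From mathcomp Require Import all_boot all_order all_algebra.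
From mathcomp Require Import all_classical all_reals all_analysis.
From mathcomp Require Import complex.
From mathcomp Require Import ring lra zify.
Import Order.TTheory GRing.Theory Num.Theory.
Import numFieldNormedType.Exports.
Local Open Scope classical_set_scope.
Local Open Scope complex_scope.
Local Open Scope ring_scope.
Set Implicit Arguments.
Unset Strict Implicit.

(** * Bloch waves and their extension from a sublattice *)

(** Nonvanishing is asked at the site 0, which lies in every sublattice [n Z], so that extension
    from the sublattice keeps it. *)
Definition bloch (R : realType) (w : R[i]) : Prop :=
  exists (c phi : int -> R[i]) (N : nat) (mu : R[i]),
    [/\ pm1 c, (0 < N)%N, forall m, c (m + N%:Z) = c m &
     [/\ Normc.normc mu = 1, forall m, phi (m + N%:Z) = mu * phi m,
         phi 0 != 0 & forall m, hopping c phi m = w * phi m]].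

Lemma int_edivP (n : nat) (m : int) : (0 < n)%N ->
  exists (k : int) (i : nat), (i < n)%N /\ m = k * n%:Z + i%:Z.
Proof.
move=> n0; exists (m %/ n%:Z)%Z, `|(m %% n%:Z)%Z|%N.
have mod_ge0 : 0 <= (m %% n%:Z)%Z by apply: modz_ge0; lia.
have := ltz_mod m (d := n%:Z) ltac:(lia); have := divz_eq m n%:Z.
by split; lia.
Qed.

Definition blockwise (T : Type) (n : nat) (f : int -> nat -> T) (m : int) : T :=
  f (m %/ n%:Z)%Z `|(m %% n%:Z)%Z|%N.

Lemma blockwiseE (T : Type) (n : nat) (f : int -> nat -> T) (k : int) (i : nat) :
  (i < n)%N -> blockwise n f (k * n%:Z + i%:Z) = f k i.
Proof.
move=> lt_in; rewrite /blockwise divzMDl ?modzMDl; last by lia.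
by rewrite divz_nat modz_nat divn_small // modn_small // addr0.
Qed.

Lemma sign_sqr (R : pzRingType) (x : R) : x = 1 \/ x = -1 -> x * x = 1.
Proof. by case=> ->; rewrite ?mulrNN mulr1. Qed.

Lemma signM (R : pzRingType) (x y : R) :
  x = 1 \/ x = -1 -> y = 1 \/ y = -1 -> x * y = 1 \/ x * y = -1.
Proof.
by case=> ->; case=> ->; rewrite ?mulrNN ?mulr1 ?mulN1r ?mul1r;
  (left; reflexivity) || (right; reflexivity).
Qed.

Lemma signN (R : pzRingType) (x : R) : x = 1 \/ x = -1 -> - x = 1 \/ - x = -1.
Proof. by case=> ->; rewrite ?opprK; (left; reflexivity) || (right; reflexivity). Qed.

(** A multiplicative primitive of [b]. Over [N] steps it is multiplied by the product of [b] over
    one period, which may be [-1]; hence the doubled period. *)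
Lemma pm1_prim (R : realType) (b : int -> R[i]) (N : nat) :
  pm1 b -> (forall m, b (m + N%:Z) = b m) ->
  exists2 e : int -> R[i], pm1 e /\ (forall m, e (m + (N.*2)%:Z) = e m) &
    forall m, e m = b m * e (m - 1).
Proof.
move=> b1 bN; pose e (m : int) : R[i] := match m with
  | Posz n => \prod_(j < n) b j.+1%:Z
  | Negz n => \prod_(j < n.+1) b (- j%:Z) end.
have e1 : pm1 e.
  have prod_pm1 n (f : nat -> R[i]) : (forall j, f j = 1 \/ f j = -1) ->
      \prod_(j < n) f j = 1 \/ \prod_(j < n) f j = -1.
    move=> f1; apply: (big_ind (fun x => x = 1 \/ x = -1)) => //; first by left.
    exact: signM.
  case=> n; first exact: (prod_pm1 n (fun j => b j.+1%:Z)).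
  exact: (prod_pm1 n.+1 (fun j => b (- j%:Z))).
have erec m : e m = b m * e (m - 1).
  case: m => [[|n]|n].
  - by rewrite /= big_ord0 big_ord_recl big_ord0 mulr1 /= oppr0 sign_sqr.
  - have -> : n.+1%:Z - 1 = n%:Z by lia.
    by rewrite /= big_ord_recr /= mulrC.
  - have -> : Negz n - 1 = Negz n.+1 by lia.
    rewrite /= [in RHS]big_ord_recr /= mulrCA.
    have -> : - n.+1%:Z = Negz n by lia.
    by rewrite sign_sqr // mulr1.
exists e; last exact: erec.
split=> // m.
(* For signs the product is the quotient, so each shift by [N] multiplies [e] by one fixed sign; two
   shifts give its square. *)
have gE k : e (k + N%:Z) * e k = e N%:Z * e 0.
  have step j : e (j + N%:Z) * e j = e (j - 1 + N%:Z) * e (j - 1).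
    rewrite erec (erec j) bN mulrACA sign_sqr // mul1r.
    by congr (e _ * _); lia.
  elim/int_rect: k => [|n IH|n IH]; rewrite ?add0r //.
    by rewrite step -IH; congr (e _ * e _); lia.
  by rewrite -IH (step (- n%:Z)); congr (e _ * e _); lia.
have := gE (m + N%:Z); rewrite -(gE m) [in RHS]mulrC.
rewrite (_ : m + N%:Z + N%:Z = m + N.*2%:Z); last by lia.
move=> /(congr1 (fun x => x * e (m + N%:Z))).
by rewrite -!mulrA sign_sqr // !mulr1.
Qed.

(* Only the sites of [n Z] carry the given Bloch wave; [-e k * alpha i] and
   [beta i] are the weights with which its values at the two ends of a block
   enter the solution of the eigenvalue equation inside the block.  The sign
   change between the two bonds at a site of [n Z] cancels the diagonal terms
   that elimination of the block interiors creates there. *)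
Lemma bloch_decimation (R : realType) (n : nat) (kappa alpha beta : nat -> R[i])
    (p w l : R[i]) :
  (1 < n)%N -> (forall i, kappa i = 1 \/ kappa i = -1) -> p = 1 \/ p = -1 ->
  kappa 1%N = 1 -> alpha 0%N = 1 -> alpha n = 0 -> beta 0%N = 0 -> beta n = 1 ->
  (forall i, (0 < i < n)%N ->
     kappa i * alpha i.-1 + alpha i.+1 = l * alpha i) ->
  (forall i, (0 < i < n)%N -> kappa i * beta i.-1 + beta i.+1 = l * beta i) ->
  beta n.-1 = alpha 1%N -> alpha n.-1 = p * beta 1%N -> beta 1%N * w = l ->
  bloch w -> bloch l.
Proof.
move=> n1 kappa1 p1 kappa11 alpha0 alphan beta0 betan alphaE betaE palin alphan1
  beta1w [a [psi [N [mu [a1 N0 aN [mu1 psiN psi0 psiE]]]]]].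
(* Elimination leaves the factor [- p * (b k * b (k - 1))] at [psi (k - 1)]; the choice
   [b k * b (k - 1) = - p * a k] turns it into [a k]. *)
have [||b [e1 eN] eE] := @pm1_prim R (fun k => - p * a k) N.
- by move=> k; apply/signM/a1/signN.
- by move=> k /=; rewrite aN.
pose C k i := if i == 0%N then b k else if i == 1%N then - b k else kappa i.
pose Phi k i := if i == 0%N then psi k
                else - b k * alpha i * psi k + beta i * psi (k + 1).
exists (blockwise n C), (blockwise n Phi), (N.*2 * n)%N, (mu ^+ 2).
have shift k i : k * n%:Z + i%:Z + (N.*2 * n)%:Z = (k + N.*2%:Z) * n%:Z + i%:Z by lia.
have psi2N k : psi (k + N.*2%:Z) = mu ^+ 2 * psi k.
  by rewrite (_ : k + N.*2%:Z = k + N%:Z + N%:Z) ?psiN ?mulrA //; lia.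
have n0 : (0 < n)%N by lia.
split.
- move=> m; have [k [i [ltin ->]]] := int_edivP m n0.
  by rewrite blockwiseE // /C; case: ifP => // _; case: ifP => // _; apply: signN.
- by rewrite muln_gt0 double_gt0 N0.
- move=> m; have [k [i [ltin ->]]] := int_edivP m n0.
  by rewrite shift !blockwiseE // /C eN.
split.
- by rewrite expr2 Normc.normcM mu1 mulr1.
- move=> m; have [k [i [ltin ->]]] := int_edivP m n0.
  rewrite shift !blockwiseE // /Phi eN.
  rewrite (_ : k + N.*2%:Z + 1 = k + 1 + N.*2%:Z); last by lia.
  by rewrite !psi2N; case: ifP => // _; ring.
- by have := blockwiseE Phi 0 n0; rewrite mul0r addr0 => ->.
(* Since [alpha n = 0] and [beta n = 1], the formula for [Phi k i] also holds at [i = n], where it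
   gives the value [psi (k + 1)] of the next site of [n Z]. *)
have PhiE k i : (i <= n)%N -> blockwise n Phi (k * n%:Z + i%:Z) = Phi k i.
  rewrite leq_eqVlt => /predU1P[->|/blockwiseE//].
  have -> : k * n%:Z + n%:Z = (k + 1) * n%:Z + 0%:Z by lia.
  rewrite blockwiseE // /Phi eqxx gtn_eqF // alphan betan.
  by rewrite mulr0 mul0r add0r mul1r.
move=> m; have [k [i [ltin ->]]] := int_edivP m n0.
rewrite /hopping blockwiseE // PhiE; last exact: ltnW.
rewrite (_ : k * n%:Z + i%:Z + 1 = k * n%:Z + i.+1%:Z); last by lia.
rewrite PhiE //; case: (posnP i) => [->|i0].
  rewrite (_ : k * n%:Z + 0%:Z - 1 = (k - 1) * n%:Z + n.-1%:Z); last by lia.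
  rewrite PhiE; last by lia.
  rewrite /C /Phi !eqxx /=.
  have -> : (n.-1 == 0)%N = false by lia.
  rewrite subrK palin alphan1.
  have pp : p * p = 1 by apply: sign_sqr.
  have bbE : b k * b (k - 1) = - p * a k.
    have b1b1 : b (k - 1) * b (k - 1) = 1 by apply/sign_sqr/e1.
    by rewrite {1}eE -mulrA b1b1 mulr1.
  transitivity (- (b k * b (k - 1)) * p * beta 1%N * psi (k - 1)
     + beta 1%N * psi (k + 1)); first by ring.
  rewrite bbE -beta1w -(mulrA _ w) -psiE /hopping.
  transitivity (p * p * (a k * beta 1%N * psi (k - 1)) + beta 1%N * psi (k + 1)).
    by ring.
  by rewrite pp; ring.
rewrite (_ : k * n%:Z + i%:Z - 1 = k * n%:Z + i.-1%:Z); last by lia.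
rewrite PhiE; last by lia.
have i0F : (i == 0)%N = false by lia.
have al := alphaE i ltac:(lia); have be := betaE i ltac:(lia).
(* For [i = 1] the coefficient [- b k] acts on the actual left neighbour [psi k]; this is the term
   that [kappa 1 = alpha 0 = 1] and [beta 0 = 0] prescribe. *)
rewrite /C /Phi i0F [i.+1 == 0%N]/=; case: (eqVneq i 1%N) al be => [->|i1] /=.
  rewrite kappa11 alpha0 beta0 mulr0 add0r mul1r => al be.
  rewrite be -(addKr 1 (alpha 2%N)) al; ring.
have -> : (i.-1 == 0)%N = false by lia.
move=> al be.
transitivity (- b k * (kappa i * alpha i.-1 + alpha i.+1) * psi k
  + (kappa i * beta i.-1 + beta i.+1) * psi (k + 1)); first by ring.
by rewrite al be; ring.
Qed.

(** * Decimation to every second, third and fifth site *)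

Lemma bloch_sqr (R : realType) (l : R[i]) : l != 0 -> bloch (l ^+ 2) -> bloch l.
Proof.
(* The list for [alpha] stops before the index [n], where the default value of [nth] supplies
   [alpha n = 0]; likewise in the next two proofs. *)
move=> l0; apply: (@bloch_decimation R 2 (fun=> 1) (nth 0 [:: 1; l^-1])
  (nth 0 [:: 0; l^-1; 1]) 1) => //=; try by [left | rewrite mul1r | rewrite expr2 mulKf].
- by case=> [|[|i]] //= _; field.
- by case=> [|[|i]] //= _; field.
Qed.

(** [D] is the characteristic polynomial of the two sites inside a block; solving for the weights
    divides by it. *)
Lemma bloch_cubic (R : realType) (l : R[i]) :
  l ^+ 3 - l != 0 -> bloch (l ^+ 3 - l) -> bloch l.
Proof.
rewrite (_ : l ^+ 3 - l = (l ^+ 2 - 1) * l); last by ring.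
set D := l ^+ 2 - 1; rewrite mulf_eq0 negb_or => /andP[D0 l0].
apply: (@bloch_decimation R 3 (fun=> 1) (nth 0 [:: 1; l / D; D^-1])
  (nth 0 [:: 0; D^-1; l / D; 1]) 1) => //=; try by [left | rewrite mul1r | rewrite mulKf].
- by case=> [|[|[|i]]] //= _; rewrite /D; field; exact: D0.
- by case=> [|[|[|i]]] //= _; rewrite /D; field; exact: D0.
Qed.

(** The negative coefficient at the third site turns the characteristic polynomial of the four inner
    sites from [l^4 - 3 l^2 + 1] into [l^4 - l^2 + 1]. It also makes the product of the inner
    coefficients, which is [p], equal to [-1]. *)
Lemma bloch_quintic (R : realType) (l : R[i]) :
  l ^+ 5 - l ^+ 3 + l != 0 -> bloch (l ^+ 5 - l ^+ 3 + l) -> bloch l.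
Proof.
rewrite (_ : l ^+ 5 - l ^+ 3 + l = (l ^+ 4 - l ^+ 2 + 1) * l); last by ring.
set D := l ^+ 4 - l ^+ 2 + 1; rewrite mulf_eq0 negb_or => /andP[D0 l0].
apply: (@bloch_decimation R 5 (fun i => if i == 3%N then -1 else 1)
  (nth 0 [:: 1; l ^+ 3 / D; (l ^+ 2 - 1) / D; - l / D; - D^-1])
  (nth 0 [:: 0; D^-1; l / D; (l ^+ 2 - 1) / D; l ^+ 3 / D; 1]) (-1)) => //=;
  try by [right | rewrite mulN1r | rewrite mulKf].
- by move=> i; case: ifP => _; [right | left].
- by case=> [|[|[|[|[|i]]]]] //= _; rewrite /D; field; exact: D0.
- by case=> [|[|[|[|[|i]]]]] //= _; rewrite /D; field; exact: D0.
Qed.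

(** * The free operator and the rotation by [i] *)

Lemma bloch_addV (R : realType) (u : R[i]) : Normc.normc u = 1 -> bloch (u + u^-1).
Proof.
move=> u1; have u0 : u != 0.
  by apply/eqP => u0; move: u1; rewrite u0 Normc.normc0 => /esym/eqP; rewrite oner_eq0.
exists (fun=> 1), (fun m => u ^ m), 1%N, u; split=> //; first by move=> ?; left.
split=> //.
- by move=> m; rewrite expfzDr // mulrC.
- by rewrite expr0z oner_neq0.
- by move=> m; rewrite /hopping !expfzDr // expr1z exprN1; ring.
Qed.

Lemma normc_i (R : realType) : Normc.normc ('i%C : R[i]) = 1.
Proof. by rewrite /= expr0n add0r expr1n sqrtr1. Qed.

Lemma normcX (R : realType) (z : R[i]) (n : nat) :
  Normc.normc (z ^+ n) = Normc.normc z ^+ n.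
Proof.
by elim: n => [|n IH]; rewrite ?Normc.normc1 // !exprS Normc.normcM IH.
Qed.

(* Conjugating [A_c] with the multiplication by [i^m] yields [- i A_(-c)]. *)
Lemma bloch_muli (R : realType) (w : R[i]) : bloch w -> bloch ('i%C * w).
Proof.
move=> [c [phi [N [mu [c1 N0 cN [mu1 phiN phi0 phiE]]]]]].
have i0 : ('i%C : R[i]) != 0.
  by rewrite eq_complex /= oner_eq0 andbF.
exists (fun m => - c m), (fun m => 'i%C ^ m * phi m), N, ('i%C ^+ N * mu).
split=> //; first by move=> m; apply/signN/c1.
  by move=> m; rewrite cN.
split.
- by rewrite Normc.normcM normcX normc_i expr1n mul1r.
- by move=> m; rewrite phiN expfzDr // -exprnP; ring.
- by rewrite expr0z mul1r.
- move=> m; rewrite /hopping [RHS]mulrCA -(mulrA 'i%C) -phiE /hopping.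
  rewrite !expfzDr // expr1z exprN1.
  have -> : ('i%C : R[i])^-1 = - 'i%C.
    by apply: (mulIf i0); rewrite mulVf // mulNr -expr2 sqr_i opprK.
  by ring.
Qed.

(** * Bloch eigenvalues belong to the spectrum *)

Lemma esum_support (R : realType) (psi : int -> R[i]) (s : seq int) :
  uniq s -> (forall m, m \notin s -> psi m = 0) ->
  (\esum_(m in [set: int]) (Normc.normc (psi m) ^+ 2)%:E =
   (\sum_(m <- s) Normc.normc (psi m) ^+ 2)%:E)%E.
Proof.
move=> us psis.
have ge0 m : [set: int] m -> (0 <= (Normc.normc (psi m) ^+ 2)%:E)%E.
  by rewrite lee_fin sqr_ge0.
rewrite (esumID [set` s]) // !setTI [X in (_ + X)%E]esum1 ?adde0; last first.
  by move=> m /= /negP /psis ->; rewrite Normc.normc0 expr0n.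
rewrite esum_fset; first last.
- by move=> m _; exact: ge0.
- exact: finite_seq.
by rewrite -fsbig_seq // sumEFin.
Qed.

Lemma finite_support_l2 (R : realType) (psi : int -> R[i]) (s : seq int) :
  uniq s -> (forall m, m \notin s -> psi m = 0) ->
  in_l2 psi /\ l2norm psi = Num.sqrt (\sum_(m <- s) Normc.normc (psi m) ^+ 2).
Proof.
move=> us psis; split; last by rewrite /l2norm (esum_support us psis).
rewrite /in_l2 /summable.
under eq_esum do rewrite gee0_abs ?lee_fin ?sqr_ge0 //.
by rewrite (esum_support us psis) ltry.
Qed.

Lemma normc_ge0 (R : realType) (z : R[i]) : 0 <= Normc.normc z.
Proof. by case: z => a b /=; rewrite sqrtr_ge0. Qed.

Lemma normc_signM (R : realType) (x z : R[i]) :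
  x = 1 \/ x = -1 -> Normc.normc (x * z) = Normc.normc z.
Proof. by case=> ->; rewrite ?mul1r ?mulN1r ?normcN. Qed.

(* Truncations of the Bloch wave to long intervals contradict the boundedness
   of an inverse of [A_c - w]: only the two ends contribute to their image. *)
Lemma bloch_pi_infty (R : realType) (w : R[i]) : bloch w -> @pi_infty R w.
Proof.
move=> [c [phi [N [mu [c1 N0 cN [mu1 phiN phi0 phiE]]]]]].
exists c; split=> //; first by exists N.
move=> [B [[_ _ [M BM]] Binv]].
have phiNL L m : Normc.normc (phi (m + (L * N)%N%:Z)) = Normc.normc (phi m).
  elim: L => [|L IH]; first by rewrite mul0n addr0.
  rewrite (_ : m + _ = m + (L * N)%N%:Z + N%:Z); last by lia.
  by rewrite phiN Normc.normcM mu1 mul1r.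
pose a := Normc.normc (phi 0) ^+ 2; pose b := Normc.normc (phi (-1)) ^+ 2.
have a0 : 0 < a.
  rewrite exprn_gt0 // lt_neqAle normc_ge0 andbT eq_sym.
  by apply: contra phi0 => /eqP/Normc.eq0_normc ->.
(* The inverse [B] sends [g] back to [psi]: [L] periods give [psi] a squared norm of at least [L a],
   while the four end terms of [g] add up to [2 a + 2 b]. *)
have bound L : (1 < L)%N -> L%:R * a <= M ^+ 2 * (2 * a + 2 * b).
  (* [1 < K] keeps the four end sites [-1], [0], [K - 1], [K] distinct. *)
  move=> L1; pose K := (L * N)%N; have K1 : (1 < K)%N by rewrite /K; nia.
  pose psi m := if (0 <= m < K%:Z) then phi m else 0.
  pose g := shifted (hopping c) w psi.
  have [psi_l2 psi_norm] := @finite_support_l2 R psi [seq j%:Z | j <- iota 0 K]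
    ltac:(by rewrite map_inj_uniq ?iota_uniq // => ? ? []) ltac:(
      move=> m; rewrite /psi; case: ifP => // m0 /negP[];
      apply/mapP; exists `|m|%N; [rewrite mem_iota; lia | lia]).
  have gE m : g m = c m * psi (m - 1) + psi (m + 1) - w * psi m by [].
  have phiw m : w * phi m = c m * phi (m - 1) + phi (m + 1) by rewrite -phiE.
  have psi_in m : 0 <= m < K%:Z -> psi m = phi m by rewrite /psi => ->.
  have psi_out m : ~~ (0 <= m < K%:Z) -> psi m = 0 by rewrite /psi => /negbTE ->.
  have [g_l2 g_norm] := @finite_support_l2 R g [:: -1; 0; K%:Z - 1; K%:Z]
    ltac:(by rewrite /= !inE; lia) ltac:(
      move=> m; rewrite !inE => m_notin; rewrite gE;
      have [m_in|m_out] := boolP (0 <= m < K%:Z);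
      [ by rewrite !psi_in; [rewrite phiw subrr | lia | lia | lia]
      | by rewrite !psi_out; [rewrite !mulr0 !addr0 subrr | lia | lia | lia] ]).
  have := BM _ g_l2; rewrite (_ : B g = psi); last first.
    by apply/funext => m; rewrite (Binv _ psi_l2).1.
  rewrite psi_norm g_norm.
  have -> : \sum_(m <- [:: -1; 0; K%:Z - 1; K%:Z]) Normc.normc (g m) ^+ 2 = 2 * a + 2 * b.
    have gN1 : Normc.normc (g (-1)) = Normc.normc (phi 0).
      rewrite gE (psi_out (-1 - 1)) // (psi_out (-1)) // psi_in; last by lia.
      by rewrite !mulr0 add0r subr0; congr (Normc.normc (phi _)); lia.
    have g0 : Normc.normc (g 0) = Normc.normc (phi (-1)).
      rewrite gE (psi_out (0 - 1)) // (psi_in (0 + 1)) ?(psi_in 0); [|lia..].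
      rewrite phiw mulr0 add0r opprD addrCA subrr addr0 sub0r normcN.
      by rewrite normc_signM.
    have gK1 : Normc.normc (g (K%:Z - 1)) = Normc.normc (phi 0).
      rewrite gE (psi_in (K%:Z - 1 - 1)) ?(psi_out (K%:Z - 1 + 1)) ?(psi_in (K%:Z - 1)); [|lia..].
      by rewrite phiw opprD addrACA subrr !add0r subrK normcN -(add0r K%:Z) phiNL.
    have gK : Normc.normc (g K%:Z) = Normc.normc (phi (-1)).
      rewrite gE (psi_in (K%:Z - 1)) ?(psi_out (K%:Z + 1)) ?(psi_out K%:Z); [|lia..].
      by rewrite mulr0 addr0 subr0 normc_signM // (addrC K%:Z) phiNL.
    by rewrite !big_cons big_nil gN1 g0 gK1 gK /a /b; ring.
  move=> le1.
  have sum_ge : L%:R * a <= \sum_(m <- [seq j%:Z | j <- iota 0 K]) Normc.normc (psi m) ^+ 2.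
    rewrite big_map (_ : \sum_(j <- _) _ = \sum_(0 <= j < K) Normc.normc (phi j%:Z) ^+ 2);
      last first.
      rewrite /index_iota subn0; apply: eq_big_seq => j; rewrite mem_iota => j_in.
      by rewrite psi_in //; lia.
    rewrite /K; elim: (L) => [|L' IH]; first by rewrite mul0r sumr_ge0 // => j; rewrite sqr_ge0.
    rewrite (@big_cat_nat _ _ _ (L' * N)%N) //=; last by nia.
    rewrite -natr1 mulrDl mul1r lerD // big_ltn; last by nia.
    have -> : Normc.normc (phi (L' * N)%N%:Z) ^+ 2 = a by rewrite -(add0r (L' * N)%N%:Z) phiNL.
    by rewrite lerDl sumr_ge0 // => j _; rewrite sqr_ge0.
  have b0 : 0 <= b by rewrite sqr_ge0.
  have S0 : 0 <= 2 * a + 2 * b by lra.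
  apply: (le_trans sum_ge); set T := \sum_(m <- _) _ in le1 *.
  have T0 : 0 <= T by rewrite sumr_ge0 // => j _; rewrite sqr_ge0.
  rewrite -(sqr_sqrtr T0) -(sqr_sqrtr S0) -exprMn lerXn2r // ?nnegrE ?sqrtr_ge0 //.
  exact: le_trans (sqrtr_ge0 _) le1.
pose x := M ^+ 2 * (2 * a + 2 * b) / a.
have := bound (Num.bound `|x|).+2 isT; rewrite -ler_pdivlMr //; apply/negP.
rewrite -ltNge; apply: (le_lt_trans (ler_norm _)).
by apply: (lt_le_trans (archi_boundP (normr_ge0 _))); rewrite ler_nat; exact: leqW (leqnSn _).
Qed.

(** * Topology of the plane through the real modulus *)

(** Radii of balls in [R[i]^o] are elements of [R[i]]; a positive one has imaginary part zero, so
    real radii suffice. *)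
Lemma nbhs_normcP (R : realType) (z : R[i]^o) (A : set R[i]^o) :
  nbhs z A <-> exists2 e : R, 0 < e & forall w, Normc.normc (w - z) < e -> A w.
Proof.
have ballE (e : R) w : ball z e%:C w = (Normc.normc (w - z) < e).
  by rewrite -ball_normE /ball_ /= -normrN opprB ltcR.
split=> [/nbhs_ballP[/= e e0 zeA]|[e e0 zeA]].
  have eE : e = (complex.Re e)%:C.
    by case: e e0 {zeA} => a b; rewrite ltcE => /andP[/eqP/= -> _].
  exists (complex.Re e) => [|w we]; first by move: e0; rewrite eE ltcR.
  by apply: zeA; rewrite eE ballE.
apply/nbhs_ballP; exists e%:C => /=; first by rewrite ltcR.
by move=> w; rewrite ballE; exact: zeA.
Qed.

Lemma closure_normcP (R : realType) (z : R[i]^o) (A : set R[i]^o) :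
  closure A z <->
  forall e : R, 0 < e -> exists2 w, A w & Normc.normc (w - z) < e.
Proof.
split=> [Az e e0|Az B /nbhs_normcP[e e0 zeB]].
  have [|w [Aw we]] := Az [set w | Normc.normc (w - z) < e].
    by apply/nbhs_normcP; exists e.
  by exists w.
by have [w Aw we] := Az _ e0; exists w; split=> //; exact: zeB.
Qed.

Lemma interior_normcP (R : realType) (z : R[i]^o) (A : set R[i]^o) :
  interior A z <->
  exists2 e : R, 0 < e & forall w, Normc.normc (w - z) < e -> A w.
Proof. exact: nbhs_normcP. Qed.

(** * Polar coordinates and quarter turns *)

Lemma expiD (R : realType) (x y : R) : expi (x + y) = expi x * expi y.
Proof. by apply/eqP; rewrite eq_complex /= cosD sinD eqxx (addrC (sin x * _)) eqxx. Qed.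

Lemma expiN (R : realType) (x : R) : expi (- x) = (expi x)^*%C.
Proof. by rewrite /expi cosN sinN. Qed.

Lemma expi0 (R : realType) : expi (0 : R) = 1.
Proof. by rewrite /expi cos0 sin0. Qed.

Lemma expiX (R : realType) (x : R) (n : nat) : expi x ^+ n = expi (x * n%:R).
Proof.
by elim: n => [|n IH]; rewrite ?mulr0 ?expi0 // exprS IH -expiD -natr1; congr expi; ring.
Qed.

Lemma expi2pi (R : realType) (k : nat) : expi (2 * pi * k%:R : R) = 1.
Proof.
rewrite -expiX (_ : expi _ = 1) ?expr1n // /expi (_ : 2 * pi = pi *+ 2); last by ring.
by rewrite cos2pi sin2pi.
Qed.

Lemma expi_pihalf (R : realType) : expi (pi / 2 : R) = 'i%C.
Proof. by rewrite /expi cos_pihalf sin_pihalf. Qed.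

Lemma normc_expi (R : realType) (x : R) : Normc.normc (expi x) = 1.
Proof. by rewrite /= cos2Dsin2 sqrtr1. Qed.

Lemma normc_real (R : realType) (r : R) : 0 <= r -> Normc.normc (r%:C) = r.
Proof. by move=> r0 /=; rewrite expr0n /= addr0 sqrtr_sqr ger0_norm. Qed.

Lemma normc_polar (R : realType) (r x : R) : 0 <= r -> Normc.normc (r%:C * expi x) = r.
Proof. by move=> r0; rewrite Normc.normcM normc_real // normc_expi mulr1. Qed.

Lemma quadrant1_polar (R : realType) (z : R[i]) : 0 <= complex.Re z -> 0 <= complex.Im z ->
  exists2 t : R, 0 <= t <= pi / 2 & z = (Normc.normc z)%:C * expi t.
Proof.
case: z => a b /= a0 b0; set r := Num.sqrt _.
have s0 : 0 <= a ^+ 2 + b ^+ 2 by rewrite addr_ge0 ?sqr_ge0.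
have r0 : 0 <= r by rewrite sqrtr_ge0.
have rE : r ^+ 2 = a ^+ 2 + b ^+ 2 by rewrite sqr_sqrtr.
have [r00|r_neq0] := eqVneq r 0.
  exists 0; first by rewrite lexx divr_ge0 ?pi_ge0.
  move: rE; rewrite r00 expr0n /= => /esym/eqP.
  rewrite paddr_eq0 ?sqr_ge0 // !sqrf_eq0 => /andP[/eqP-> /eqP->].
  by rewrite mul0r.
have r_gt0 : 0 < r by rewrite lt_neqAle eq_sym r_neq0.
have ar : a <= r by rewrite -(@ler_pXn2r _ 2) ?nnegrE // rE lerDl sqr_ge0.
have ar0 : 0 <= a / r by rewrite divr_ge0.
have ar1 : a / r <= 1 by rewrite ler_pdivrMr // mul1r.
have ar_in : -1 <= a / r <= 1 by rewrite ar1 andbT; lra.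
have bE : Num.sqrt (1 - (a / r) ^+ 2) = b / r.
  have -> : 1 - (a / r) ^+ 2 = (b / r) ^+ 2.
    apply: (mulIf (expf_neq0 2 r_neq0)).
    by rewrite mulrBl mul1r -!exprMn !divfK // rE; ring.
  by rewrite sqrtr_sqr ger0_norm // divr_ge0.
exists (acos (a / r)).
  rewrite acos_ge0 //= -acos0 leNgt; apply/negP => lt0.
  have : cos (acos (a / r)) < cos (acos 0).
    rewrite ltr_cos ?in_itv //= ?acos_ge0 ?acos_lepi //; lra.
  by rewrite !acosK ?in_itv //=; lra.
rewrite /expi sin_acos // bE acosK ?in_itv //.
by simpc; rewrite !(mulrC r) !divfK.
Qed.

(** One of [z], [i z], [i^2 z], [i^3 z] lies in the closed first quadrant. *)
Lemma quadrant_ind (R : realType) (P : R[i] -> Prop) :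
  (forall z, P ('i%C * z) -> P z) ->
  (forall z, 0 <= complex.Re z -> 0 <= complex.Im z -> P z) -> forall z, P z.
Proof.
move=> Pmuli P1; have P2 z : complex.Re z <= 0 -> 0 <= complex.Im z -> P z.
  case: z => a b /= a0 b0; do 3!apply: (Pmuli); apply: P1; simpc => /=; lra.
have P3 z : complex.Im z <= 0 -> P z.
  case: z => a b /= b0; have [a0|/ltW a0] := leP a 0.
    by do 2!apply: (Pmuli); apply: P1; simpc => /=; lra.
  by apply: (Pmuli); apply: P1; simpc => /=; lra.
move=> z; have [z0|/ltW/P3//] := leP 0 (complex.Im z).
by have [r0|/ltW r0] := leP 0 (complex.Re z); [exact: P1 | exact: P2].
Qed.

(** * Density of Bloch eigenvalues in the unit disc *)

(** [r] is twice the real part of a point [u] of the unit circle, that is, [u + u^-1]. *)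
Lemma bloch_real (R : realType) (r : R) : 0 <= r <= 2 -> bloch r%:C.
Proof.
move=> /andP[r0 r2]; pose u : R[i] := (r / 2) +i* Num.sqrt (1 - (r / 2) ^+ 2).
have u_ge0 : 0 <= 1 - (r / 2) ^+ 2 by nra.
have uu : u * u^*%C = 1.
  apply/eqP; rewrite eq_complex /=; apply/andP; split; apply/eqP.
    by rewrite mulrN opprK -(expr2 (Num.sqrt _)) sqr_sqrtr //; ring.
  by ring.
have u0 : u != 0 by apply/eqP => u0; move: uu; rewrite u0 mul0r => /esym/eqP; rewrite oner_eq0.
have uV : u^-1 = u^*%C by rewrite -[RHS](mulKf u0) uu mulr1.
have -> : r%:C = u + u^-1.
  by rewrite uV; apply/eqP; rewrite eq_complex /= subrr eqxx andbT; apply/eqP; field.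
by apply: bloch_addV; rewrite /= sqr_sqrtr // addrC subrK sqrtr1.
Qed.

Lemma bloch_root2 (R : realType) (n : nat) (w : R[i]) :
  w != 0 -> bloch (w ^+ (2 ^ n)) -> bloch w.
Proof.
move=> w0; elim: n => [|n IH]; first by rewrite expr1.
rewrite expnSr exprM => bw; apply: IH; apply: bloch_sqr => //.
exact: expf_neq0.
Qed.

(** The multiples of [2 pi / 2^n] have spacing below [d] once [n] exceeds [2 pi / d], because
    [n < 2^n]; [k] indexes the last multiple not beyond [t]. *)
Lemma dyadic_angle (R : realType) (t d : R) : 0 <= t -> 0 < d ->
  exists n k : nat, `|2 * pi * k%:R / (2 ^ n)%:R - t| < d.
Proof.
move=> t0 d0; have tau0 : 0 < 2 * pi :> R by rewrite mulr_gt0 ?pi_gt0.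
set n := Num.bound (2 * pi / d); pose D : R := (2 ^ n)%:R.
have D0 : 0 < D by rewrite ltr0n expn_gt0.
have nD : 2 * pi / D < d.
  rewrite ltr_pdivrMr // (mulrC d) -ltr_pdivrMr //.
  have xd0 : 0 <= 2 * pi / d by rewrite divr_ge0 ?ltW.
  apply: (lt_trans (archi_boundP xd0)).
  by rewrite ltr_nat ltn_expl.
exists n, (Num.truncn (t * D / (2 * pi))); rewrite -/D; set k := Num.truncn _.
have x0 : 0 <= t * D / (2 * pi) by rewrite divr_ge0 ?(ltW tau0) // mulr_ge0 ?(ltW D0).
have /andP[] := truncn_itv x0; rewrite -/k ler_pdivlMr // ltr_pdivrMr // => k1 k2.
have tE : t = t * D / D by rewrite mulfK // gt_eqF.
rewrite distrC {1}tE -mulrBl ger0_norm.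
  apply: le_lt_trans nD; rewrite ler_wpM2r ?invr_ge0 ?(ltW D0) //.
  by move: k2; rewrite -natr1; nra.
by rewrite divr_ge0 ?(ltW D0) // subr_ge0; nra.
Qed.

Lemma normc_expiB (R : realType) (x y : R) :
  Normc.normc (expi x - expi y) ^+ 2 = 2 - 2 * cos (x - y).
Proof.
rewrite /= sqr_sqrtr ?addr_ge0 ?sqr_ge0 // cosB.
by have := cos2Dsin2 x; have := cos2Dsin2 y; nra.
Qed.

(** The squared distance is [2 - 2 cos (x - y)], so continuity of the cosine at 0 gives a [d]
    uniform in both angles. *)
Lemma expi_near (R : realType) (e : R) : 0 < e -> exists2 d : R, 0 < d &
  forall x y : R, `|x - y| < d -> Normc.normc (expi x - expi y) < e.
Proof.
move=> e0; have e2 : 0 < e ^+ 2 / 2 by rewrite divr_gt0 ?exprn_gt0.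
have /cvgrPdist_lt/(_ _ e2) := @continuous_cos R 0.
move=> /nbhs_ballP[d /= d0 cosd]; exists d => // x y xy.
have /cosd : ball 0 d (x - y) by rewrite -ball_normE /ball_ /= sub0r normrN.
rewrite cos0 => /(le_lt_trans (ler_norm _)) cos_lt.
rewrite -(@ltr_pXn2r _ 2) ?nnegrE ?normc_ge0 ?(ltW e0) // normc_expiB; lra.
Qed.

(* The points [r e^(2 i pi k / 2^n)], with [0 < r < 1], are [2^n]-th roots of
   numbers in the interval [(0, 1)] of the spectrum of the free operator. *)
Lemma bloch_dense (R : realType) (z : R[i]) (e : R) :
  Normc.normc z < 1 -> 0 < e ->
  exists w, [/\ bloch w, w != 0 & Normc.normc (w - z) < e].
Proof.
move=> z1 e0; have [->|] := eqVneq z 0.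
  pose r : R := Num.min 1 (e / 2).
  have r0 : 0 < r by rewrite lt_min ltr01 divr_gt0.
  exists r%:C; split.
  - by apply: bloch_real; rewrite ltW //= ge_min; apply/orP; left; lra.
  - by apply/eqP => /(congr1 (@complex.Re R)) /= r00; move: r0; rewrite r00 ltxx.
  - by rewrite subr0 normc_real ?ltW // gt_min; apply/orP; right; lra.
elim/quadrant_ind: z z1 => [z IH z1 z0|z Rez Imz z1 z0].
  have i0 : ('i%C : R[i]) != 0 by rewrite eq_complex /= oner_eq0 andbF.
  have i2 : 'i%C * 'i%C = -1 :> R[i] by rewrite -expr2 sqr_i.
  have [||w [bw w0 wz]] := IH.
  - by rewrite Normc.normcM normc_i mul1r.
  - by rewrite mulf_neq0.
  (* As [i^4 = 1], multiplication by [i^3] carries an approximation of [i z] to one of [z]. *)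
  exists ('i%C * ('i%C * ('i%C * w))); split; first by do 3!apply: bloch_muli.
    by rewrite !mulf_neq0.
  rewrite (_ : _ - z = ('i%C * 'i%C) * 'i%C * (w - 'i%C * z)); last first.
    by rewrite mulrBr !mulrA -(mulrA ('i%C * 'i%C) 'i%C 'i%C) i2 mulrNN mul1r mul1r.
  by rewrite !Normc.normcM normc_i !mul1r.
set r := Normc.normc z in z1; have [t /andP[t0 _] zE] := quadrant1_polar Rez Imz.
rewrite -/r in zE; have r0 : 0 < r.
  rewrite lt_neqAle normc_ge0 andbT eq_sym; apply: contra z0 => /eqP.
  by rewrite zE => ->; rewrite mul0r.
have [d d0 expid] := expi_near e0; have [n [k kt]] := dyadic_angle t0 d0.
set s := _ / _ in kt.
have w0 : r%:C * expi s != 0.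
  apply/eqP => /(congr1 (@Normc.normc R)).
  by rewrite normc_polar ?ltW // Normc.normc0 => r00; move: r0; rewrite r00 ltxx.
exists (r%:C * expi s); split=> //.
  apply: (@bloch_root2 _ n) => //; rewrite exprMn expiX.
  have D0 : (2 ^ n)%:R != 0 :> R by rewrite pnatr_eq0 expn_eq0.
  rewrite /s divfK // expi2pi mulr1 -rmorphXn; apply: bloch_real.
  rewrite exprn_ge0 ?(ltW r0) //=; apply: (@le_trans _ _ 1); last by rewrite ler1n.
  by rewrite exprn_ile1 // ltW.
rewrite [X in _ - X]zE -mulrBr Normc.normcM normc_real ?ltW //.
apply: le_lt_trans (expid _ _ kt); rewrite -[leRHS]mul1r.
by rewrite ler_wpM2r ?normc_ge0 ?ltW.
Qed.

(** * Preimages of the unit disc under monic polynomials *)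

(** The modulus of [p.[l]] is the product of the distances from [l] to the [n + 1] roots, so they
    cannot all be at least [e]. *)
Lemma root_near (R : realType) (p : {poly R[i]}) (n : nat) (l : R[i]) (e : R) :
  p \is monic -> size p = n.+2 -> 0 < e -> Normc.normc p.[l] < e ^+ n.+1 ->
  exists2 z, root p z & Normc.normc (z - l) < e.
Proof.
move=> pm sp e0 pl; have [s pE] := closed_field_poly_normal p.
move: pE; rewrite (monicP pm) scale1r => pE.
have [/hasP[z zs zl]|/hasPn far] := boolP (has (fun z => Normc.normc (z - l) < e) s).
  by exists z; rewrite // pE root_prod_XsubC.
have ss : size s = n.+1 by move: sp; rewrite pE size_prod_XsubC => -[].
suff : e ^+ n.+1 <= Normc.normc p.[l] by rewrite leNgt pl.
rewrite pE -ss horner_prod; elim: (s) far => [|z s' IH] far.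
  by rewrite big_nil expr0 Normc.normc1.
rewrite big_cons Normc.normcM exprS ler_pM ?exprn_ge0 ?(ltW e0) //.
  rewrite hornerXsubC -normcN opprB leNgt.
  by apply: far; rewrite mem_head.
by apply: IH => x xs; apply: far; rewrite inE xs orbT.
Qed.

Lemma continuous_hornerC (R : realType) (p : {poly R[i]}) :
  continuous (fun z : R[i]^o => p.[z] : R[i]^o).
Proof.
elim/poly_ind: p => [|p c IH].
  rewrite (_ : (fun z : R[i]^o => _) = cst 0); first exact: cst_continuous.
  by apply/funext => z; rewrite horner0.
pose f (z : R[i]^o) : R[i]^o := p.[z]; pose g (z : R[i]^o) : R[i]^o := z.
rewrite (_ : (fun z : R[i]^o => _) = (f \* g) + cst c).
  move=> z; apply: (@continuousD _ R[i]^o R[i]^o (f \* g) (cst c) z).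
    by apply: continuousM; [exact: IH | by move=> ?].
  exact: cst_continuous.
by apply/funext => z; rewrite hornerMXaddC.
Qed.

(** If [p.[z]] lies in the unit disc, some nonzero Bloch eigenvalue [w] is within [e^(n+1)] of it,
    and [p - w] then has a root within [e] of [z]. Continuity of [p] passes from the closure to its
    interior. *)
Lemma bloch_preimage (R : realType) (p : {poly R[i]}) (n : nat) (l : R[i]) :
  p \is monic -> size p = n.+2 ->
  (forall z, p.[z] != 0 -> bloch p.[z] -> bloch z) ->
  Normc.normc p.[l] < 1 -> interior (closure (@bloch R : set R[i]^o)) l.
Proof.
move=> pm sp pbloch pl.
have inS z : Normc.normc p.[z] < 1 -> closure (@bloch R : set R[i]^o) z.
  move=> pz; apply/closure_normcP => e e0.
  have [w [bw w0 wz]] := bloch_dense pz (exprn_gt0 n.+1 e0).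
  have spw : (size (- w%:P) < size p)%N.
    by rewrite size_polyN (leq_ltn_trans (size_polyC_leq1 _)) // sp.
  have [|||y yroot yz] := @root_near R (p - w%:P) n z e _ _ e0.
  - by rewrite monicE lead_coefDl // -monicE.
  - by rewrite size_polyDl.
  - by rewrite !hornerE -normcN opprB.
  have {}yroot : p.[y] = w.
    by move: yroot; rewrite /root !hornerE subr_eq0 => /eqP.
  by exists y => //; apply: pbloch; rewrite yroot.
have e0 : 0 < 1 - Normc.normc p.[l] by rewrite subr_gt0.
have : nbhs (p.[l] : R[i]^o) [set w : R[i]^o | Normc.normc w < 1].
  apply/nbhs_normcP; exists (1 - Normc.normc p.[l]) => // w /= wl.
  rewrite -(subrK p.[l] w); apply: (le_lt_trans (le_normcD _ _)).
  by rewrite -ltrBrDr.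
move=> /(@continuous_hornerC R p l) /nbhs_normcP[d d0 ld].
by apply/interior_normcP; exists d => // z zl; apply/inS/ld.
Qed.

Lemma cubic_disc (R : realType) (l : R[i]) :
  Normc.normc (l ^+ 3 - l) < 1 -> interior (closure (@bloch R : set R[i]^o)) l.
Proof.
move=> hl; pose p : {poly R[i]} := 'X^3 - 'X.
have pE z : p.[z] = z ^+ 3 - z by rewrite !hornerE.
have sp : (size (- 'X : {poly R[i]}) < size ('X^3 : {poly R[i]}))%N.
  by rewrite size_polyN size_polyX size_polyXn.
apply: (@bloch_preimage R p 2 l); rewrite ?pE //.
- by rewrite monicE /p (lead_coefDl sp) lead_coefXn.
- by rewrite /p (size_polyDl sp) size_polyXn.
- by move=> z; rewrite pE; exact: bloch_cubic.
Qed.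

Lemma sextic_disc (R : realType) (l : R[i]) :
  Normc.normc (l ^+ 6 + l ^+ 2) < 1 -> interior (closure (@bloch R : set R[i]^o)) l.
Proof.
move=> hl; pose p : {poly R[i]} := 'X^6 + 'X^2.
have pE z : p.[z] = z ^+ 6 + z ^+ 2 by rewrite !hornerE.
have sp : (size ('X^2 : {poly R[i]}) < size ('X^6 : {poly R[i]}))%N.
  by rewrite !size_polyXn.
apply: (@bloch_preimage R p 5 l); rewrite ?pE //.
- by rewrite monicE /p (lead_coefDl sp) lead_coefXn.
- by rewrite /p (size_polyDl sp) size_polyXn.
(* The property passes from [p.[z]] to [i p.[z] = m^3 - m], then to [m], to [i m = z^2] and finally
   to [z]. *)
move=> z; rewrite pE; set m := - ('i%C * z ^+ 2).
have i2 : 'i%C ^+ 2 = -1 :> R[i] by rewrite sqr_i.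
have i0 : ('i%C : R[i]) != 0 by rewrite eq_complex /= oner_eq0 andbF.
have mE : m ^+ 3 - m = 'i%C * (z ^+ 6 + z ^+ 2).
  rewrite /m; transitivity (- ('i%C ^+ 2) * 'i%C * z ^+ 6 + 'i%C * z ^+ 2); first by ring.
  by rewrite i2; ring.
move=> z0 /bloch_muli; rewrite -mE => /bloch_cubic.
rewrite mE mulf_neq0 // => /(_ isT) /bloch_muli.
rewrite (_ : 'i%C * m = z ^+ 2); last first.
  by transitivity (- ('i%C ^+ 2) * z ^+ 2); [rewrite /m; ring | rewrite i2; ring].
apply: bloch_sqr; apply: contra z0 => /eqP ->.
by rewrite !expr0n addr0.
Qed.

Lemma quintic_disc (R : realType) (l : R[i]) :
  Normc.normc (l ^+ 5 - l ^+ 3 + l) < 1 -> interior (closure (@bloch R : set R[i]^o)) l.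
Proof.
move=> hl; pose p : {poly R[i]} := 'X^5 + ('X - 'X^3).
have pE z : p.[z] = z ^+ 5 - z ^+ 3 + z.
  by rewrite /p !(hornerD, hornerN, hornerXn, hornerX) addrA addrAC.
have sp : (size ('X - 'X^3 : {poly R[i]})%R < size ('X^5 : {poly R[i]}))%N.
  rewrite size_polyXn (leq_ltn_trans (size_polyD _ _)) //.
  by rewrite size_polyN size_polyX size_polyXn.
apply: (@bloch_preimage R p 4 l); rewrite ?pE //.
- by rewrite monicE /p (lead_coefDl sp) lead_coefXn.
- by rewrite /p (size_polyDl sp) size_polyXn.
- by move=> z; rewrite pE; exact: bloch_quintic.
Qed.

Lemma closure_bloch_muli (R : realType) (z : R[i]) :
  closure (@bloch R : set R[i]^o) z -> closure (@bloch R : set R[i]^o) ('i%C * z).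
Proof.
move=> /closure_normcP zcl; apply/closure_normcP => e /zcl[w bw wz].
exists ('i%C * w); first exact: bloch_muli.
by rewrite -mulrBr Normc.normcM normc_i mul1r.
Qed.

Lemma interior_bloch_muli (R : realType) (z : R[i]) :
  interior (closure (@bloch R : set R[i]^o)) z ->
  interior (closure (@bloch R : set R[i]^o)) ('i%C * z).
Proof.
move=> /interior_normcP[e e0 ze]; apply/interior_normcP; exists e => // w wz.
have ii : 'i%C * - 'i%C = 1 :> R[i] by rewrite mulrN -expr2 sqr_i opprK.
rewrite -(mul1r w) -ii -mulrA; apply/closure_bloch_muli/ze.
rewrite -[z]mul1r -ii [X in X * z]mulrC -mulrA -mulrBr.
by rewrite Normc.normcM normcN normc_i mul1r.
Qed.

Lemma interior_bloch_Sigma_pi (R : realType) (z : R[i]) :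
  interior (closure (@bloch R : set R[i]^o)) z -> interior (@Sigma_pi R) z.
Proof. by apply: interiorS; apply: closure_subset; exact: bloch_pi_infty. Qed.

(** * The largest root of the cubic *)

(** [s^3 - 2 t s^2 + s - 1 = (s - 1) (s^2 + 1) - (2 t - 1) s^2] is negative for [s < 1]. *)
Lemma sfun_ge1 (R : realType) (t : R) : 1 / 2 <= t -> 1 <= Defs.sfun t.
Proof.
move=> t_ge; have [s0 sE _] := sfunP t; rewrite leNgt; apply/negP => s1.
set s := Defs.sfun t in s0 sE s1.
have : 0 <= (2 * t - 1) * s ^+ 2 by rewrite mulr_ge0 ?sqr_ge0 //; lra.
have : 0 < (1 - s) * (s ^+ 2 + 1) by rewrite mulr_gt0 ?subr_gt0 // ltr_wpDl ?sqr_ge0.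
by rewrite !mulrDr !mulrDl; nra.
Qed.

(** The difference quotient at [t = 1] is a polynomial in [x - 1] and [y - 1] with nonnegative
    coefficients; a smaller [t] adds [2 (1 - t) (x + y)]. *)
Lemma cubic_incr (R : realType) (t x y : R) : t <= 1 -> 1 <= x -> x < y ->
  x ^+ 3 - 2 * t * x ^+ 2 + x < y ^+ 3 - 2 * t * y ^+ 2 + y.
Proof.
move=> t1 x1 xy; rewrite -subr_gt0.
rewrite (_ : _ - _ = (y - x) *
  (((y - 1) ^+ 2 + (x - 1) ^+ 2 + (y - 1) * (x - 1) + (y - 1) + (x - 1))
   + 2 * (1 - t) * (x + y))); last by ring.
rewrite mulr_gt0 ?subr_gt0 // ltr_wpDr ?mulr_ge0 //; [lra | lra |].
by have := sqr_ge0 (y - 1); have := sqr_ge0 (x - 1); nra.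
Qed.

Lemma lt_sfun (R : realType) (t s : R) : 1 / 2 <= t <= 1 -> 0 <= s ->
  s < Defs.sfun t -> s ^+ 3 - 2 * t * s ^+ 2 + s < 1.
Proof.
move=> /andP[t_ge t_le] s0 st; have [s1|s1] := leP 1 s.
  by have [_ sE _] := sfunP t; rewrite -[ltRHS]sE cubic_incr.
have : 0 <= (2 * t - 1) * s ^+ 2 by rewrite mulr_ge0 ?sqr_ge0 //; lra.
have : 0 < (1 - s) * (s ^+ 2 + 1) by rewrite mulr_gt0 ?subr_gt0 // ltr_wpDl ?sqr_ge0.
by rewrite !mulrDr !mulrDl; nra.
Qed.

Lemma ge_sfun (R : realType) (t s : R) : 1 / 2 <= t <= 1 -> Defs.sfun t <= s ->
  1 <= s /\ 1 <= s ^+ 3 - 2 * t * s ^+ 2 + s.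
Proof.
move=> /andP[t_ge t_le] st; have s1 := sfun_ge1 t_ge.
split; first exact: le_trans st.
have [_ sE _] := sfunP t; rewrite -[leLHS]sE.
by move: st; rewrite le_eqVlt => /predU1P[->//|st]; rewrite ltW // cubic_incr.
Qed.

(** * Trigonometric values *)

Lemma cos_pi3 (R : realType) : cos (pi / 3) = 1 / 2 :> R.
Proof.
set c := cos _.
have c0 : 0 < c.
  by apply: cos_gt0_pihalf; have := pi_gt0 R; lra.
have : 4 * c ^+ 3 - 3 * c = -1.
  rewrite -(@cospi R) (_ : pi = pi / 3 + pi / 3 *+ 2); last by rewrite mulr2n; field.
  rewrite cosD cos_mulr2n sin_mulr2n -/c.
  have := cos2Dsin2 (pi / 3 : R); rewrite -/c => h.
  rewrite (_ : sin (pi / 3) * _ = (sin (pi / 3)) ^+ 2 * c *+ 2); last by ring.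
  by rewrite sin2cos2 -/c; ring.
(* The triple angle equation [4 c^3 - 3 c = cos pi] has a double root at [1 / 2]; its other root is
   negative. *)
move=> c3; have /eqP : (c + 1) * (2 * c - 1) ^+ 2 = 0.
  by transitivity (4 * c ^+ 3 - 3 * c + 1); [ring | rewrite c3; ring].
rewrite mulf_eq0 sqrf_eq0 => /orP[]/eqP; lra.
Qed.

Lemma sin_pi6 (R : realType) : sin (pi / 6) = 1 / 2 :> R.
Proof.
rewrite -cos_pi3 -[in LHS]cosBpihalf -[LHS]cosN; by congr cos; field.
Qed.

Lemma sin_pi3 (R : realType) : sin (pi / 3) = Num.sqrt 3 / 2 :> R.
Proof.
have s0 : 0 <= sin (pi / 3) :> R by apply: sin_ge0_pi; have := pi_gt0 R; lra.
rewrite -[LHS]ger0_norm // -sqrtr_sqr sin2cos2 cos_pi3.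
rewrite (_ : 1 - _ = 3 * (1 / 2) ^+ 2); last by field.
by rewrite sqrtrM // sqrtr_sqr ger0_norm // mul1r.
Qed.

Lemma cos_pi6 (R : realType) : cos (pi / 6) = Num.sqrt 3 / 2 :> R.
Proof.
by rewrite -sin_pi3 -[RHS]cosBpihalf -[LHS]cosN; congr cos; field.
Qed.

Lemma cos2_sector (R : realType) (x : R) : - (pi / 6) <= x <= pi / 6 ->
  1 / 2 <= cos (2 * x) <= 1.
Proof.
move=> x6; rewrite cos_le1 andbT -cos_pi3 leNgt; apply/negP.
have pi0 := pi_gt0 R; have x2 : `|2 * x| <= pi / 3 by rewrite ler_norml; lra.
rewrite -cos_norm ltr_cos ?in_itv //= ?normr_ge0; [|lra..].
by rewrite ltNge x2.
Qed.

Lemma normc_expi_dist (R : realType) (r x y : R) :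
  Normc.normc (r%:C * expi x - expi y) ^+ 2 = r ^+ 2 - 2 * r * cos (x - y) + 1.
Proof.
rewrite /= sqr_sqrtr ?addr_ge0 ?sqr_ge0 // cosB.
transitivity (r ^+ 2 * (cos x ^+ 2 + sin x ^+ 2) + (cos y ^+ 2 + sin y ^+ 2) -
  2 * r * (cos x * cos y + sin x * sin y)); first by ring.
by rewrite !cos2Dsin2; ring.
Qed.

(** * The pieces of [W] inside the three polynomial preimages *)

(** For [l = r e^(i x)], [s = r^2] and [t = cos (2 x)], the squared modulus of [l^3 - l] is
    [s^3 - 2 t s^2 + s]. *)
Lemma W1_interior (R : realType) (z : R[i]) : @W1 R z ->
  interior (closure (@bloch R : set R[i]^o)) z.
Proof.
move=> [r [x [/andP[r0 rS] /cos2_sector x6 ->]]]; apply: cubic_disc.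
have r2 : r ^+ 2 < Defs.sfun (cos (2 * x)).
  have [s0 _ _] := sfunP (cos (2 * x)).
  by rewrite -(sqr_sqrtr (ltW s0)) ltrXn2r.
rewrite -(@ltr_pXn2r _ 2) ?nnegrE ?normc_ge0 // expr1n.
rewrite (_ : _ - _ = (r%:C * expi x) * ((r ^+ 2)%:C * expi (x * 2) - expi 0)); last first.
  by rewrite -expiX rmorphXn /= expi0; ring.
rewrite Normc.normcM exprMn normc_polar // normc_expi_dist subr0 (mulrC x).
apply: le_lt_trans (lt_sfun x6 (sqr_ge0 r) r2).
by rewrite le_eqVlt; apply/orP; left; apply/eqP; ring.
Qed.

(** The squared modulus of [l^6 + l^2] is the same cubic, now with [s = r^4] and
    [t = cos (4 x - pi)]. *)
Lemma W2_interior (R : realType) (z : R[i]) : @W2 R z ->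
  interior (closure (@bloch R : set R[i]^o)) z.
Proof.
move=> [r [x [/andP[r0 rS] x36 ->]]]; apply: sextic_disc.
have /cos2_sector y6 : - (pi / 6) <= 2 * x - pi / 2 <= pi / 6 by lra.
move: rS y6; rewrite /Sfun; set t := cos _ => rS y6.
have r4 : r ^+ 4 < Defs.sfun t.
  have [s0 _ _] := sfunP t.
  rewrite -(sqr_sqrtr (ltW s0)) -[Num.sqrt (Defs.sfun t)]sqr_sqrtr ?sqrtr_ge0 //.
  by rewrite -exprM ltrXn2r.
rewrite -(@ltr_pXn2r _ 2) ?nnegrE ?normc_ge0 // expr1n.
rewrite (_ : _ + _ = (r%:C * expi x) ^+ 2 * ((r ^+ 4)%:C * expi (x * 4) - expi pi)); last first.
  rewrite -expiX rmorphXn /= (_ : expi pi = -1); first by ring.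
  by rewrite /expi cospi sinpi; apply/eqP; rewrite eq_complex /= oppr0 !eqxx.
rewrite Normc.normcM normcX exprMn normc_polar // normc_expi_dist.
rewrite (_ : x * 4 - pi = 2 * (2 * x - pi / 2)) -/t; last by field.
apply: le_lt_trans (lt_sfun y6 (exprn_ge0 4 r0) r4).
by rewrite le_eqVlt; apply/orP; left; apply/eqP; ring.
Qed.

(** The quintic is [z (z - a) (z - b) (z + b) (z + a)]. With [z] closer than [eta] to [a], its
    factors have moduli below [1 + eta], [eta], [1 + eta], [sqrt 3 + eta] and [2 + eta], whose
    product is 1 by the equation for [eta]. *)
Lemma eta_disc_interior (R : realType) (x : R) (z : R[i]) :
  cos x = Num.sqrt 3 / 2 -> sin x ^+ 2 = 1 / 4 -> eta_disc (expi x) z ->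
  interior (closure (@bloch R : set R[i]^o)) z.
Proof.
move=> cx sx [w w1 <- {z}]; apply: quintic_disc.
have [eta0 etaE] := etaP R; set e := eta R in eta0 etaE *.
set a := expi x; set b := expi (- x); set d := e * Normc.normc w.
have w1' : Normc.normc w < 1 by [].
have d0 : 0 <= d by rewrite mulr_ge0 ?normc_ge0 // ltW.
have de : d < e by rewrite -[ltRHS]mulr1 ltr_pM2l.
have q0 : 0 <= Num.sqrt 3 :> R by exact: sqrtr_ge0.
have a1 : Normc.normc a = 1 by exact: normc_expi.
have near (c : R[i]) : Normc.normc (c + e%:C * w) <= Normc.normc c + d.
  apply: le_trans (le_normcD _ _) _.
  by rewrite Normc.normcM normc_real // ltW.
have amb : Normc.normc (a - b) = 1.
  rewrite /a /b expiN /= subrr expr0n add0r opprK -mulr2n -mulr_natl exprMn sx.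
  by rewrite (_ : 2 ^+ 2 * _ = 1) ?sqrtr1 //; field.
have apb : Normc.normc (a + b) = Num.sqrt 3.
  rewrite /a /b expiN /= subrr expr0n addr0 sqrtr_sqr cx.
  by rewrite -splitr ger0_norm.
have ab : a * b = 1 by rewrite -expiD subrr expi0.
have a2b2 : a ^+ 2 + b ^+ 2 = 1.
  transitivity ((a + b) ^+ 2 - 2 * (a * b)); first by ring.
  rewrite ab (_ : a + b = (Num.sqrt 3)%:C); last first.
    by apply/eqP; rewrite eq_complex /b expiN /= cx subrr eqxx andbT -splitr.
  by rewrite -rmorphXn /= sqr_sqrtr // rmorph_nat; ring.
set z := a + e%:C * w.
have -> : z ^+ 5 - z ^+ 3 + z = (e%:C * w) * (z * (a - b + e%:C * w)) *
    (a + b + e%:C * w) * (a + a + e%:C * w).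
  transitivity (z ^+ 5 - (a ^+ 2 + b ^+ 2) * z ^+ 3 + (a * b) ^+ 2 * z).
    by rewrite a2b2 ab; ring.
  by rewrite /z; ring.
have aa : Normc.normc (a + a) = 2.
  rewrite (_ : a + a = (2 : R)%:C * a); last by rewrite rmorph_nat; ring.
  by rewrite Normc.normcM a1 mulr1 normc_real.
rewrite -etaE !Normc.normcM normc_real ?(ltW eta0) // -/d.
have h1 : Normc.normc z * Normc.normc (a - b + e%:C * w) < (1 + e) ^+ 2.
  rewrite expr2 ltr_pM ?normc_ge0 //.
    by apply: le_lt_trans (near _) _; rewrite a1 ltrD2l.
  by apply: le_lt_trans (near _) _; rewrite amb ltrD2l.
have h2 : Normc.normc (a + b + e%:C * w) < Num.sqrt 3 + e.
  by apply: le_lt_trans (near _) _; rewrite apb ltrD2l.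
have h3 : Normc.normc (a + a + e%:C * w) < 2 + e.
  by apply: le_lt_trans (near _) _; rewrite aa ltrD2l.
apply: ltr_pM (ltr_pM _ _ (ltr_pM _ _ de h1) h2) h3 => //; do ?apply: mulr_ge0 => //; exact: normc_ge0.
Qed.

(** * Numerical estimates near the corners *)

(** Both bounds are convergents of the continued fraction of [sqrt 3]. *)
Lemma sqrt3_itv (R : realType) : 19 / 11 <= (Num.sqrt 3 : R) <= 26 / 15.
Proof.
have q0 : 0 <= Num.sqrt 3 :> R by exact: sqrtr_ge0.
have q2 : Num.sqrt 3 ^+ 2 = 3 :> R by exact: sqr_sqrtr.
by apply/andP; split; nra.
Qed.

(** The left side of the equation for [eta] increases and is still below 1 at [4 / 23]. *)
Lemma eta_gt (R : realType) : 4 / 23 < eta R.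
Proof.
have [e0 eE] := etaP R; rewrite ltNge; apply/negP => e_le.
have /andP[q_ge q_le] := sqrt3_itv R.
suff : eta R * (1 + eta R) ^+ 2 * (Num.sqrt 3 + eta R) * (2 + eta R) <=
    4 / 23 * (27 / 23) ^+ 2 * (26 / 15 + 4 / 23) * (50 / 23) by rewrite eE; lra.
have e1 : (1 + eta R) ^+ 2 <= (27 / 23) ^+ 2 by rewrite lerXn2r ?nnegrE; lra.
apply: ler_pM (ler_pM _ _ (ler_pM _ _ e_le e1) _) _.
- by rewrite !mulr_ge0 ?sqr_ge0 ?addr_ge0 ?sqrtr_ge0 ?ltW.
- by lra.
- by rewrite mulr_ge0 ?sqr_ge0 // ltW.
- by lra.
- by lra.
- exact: sqr_ge0.
- by lra.
- by lra.
Qed.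

(** [d] stands for the angular distance to a corner; the product in the last formula is the excess
    of [t] over its corner value [1 / 2]. *)
Lemma sin_cos_sector (R : realType) (d : R) : 0 <= d <= pi / 6 ->
  [/\ 0 <= sin d, sin d <= 1 / 2, 0 <= cos d & cos (pi / 3 - 2 * d) =
      1 / 2 + sin d * (Num.sqrt 3 * cos d - sin d)].
Proof.
move=> /andP[d0 d6]; have pi0 := pi_gt0 R; split.
- by apply: sin_ge0_pi; lra.
- by rewrite -sin_pi6 leNgt ltr_sin ?in_itv /= -?leNgt //; lra.
- by apply: cos_ge0_pihalf; lra.
- by rewrite cosB cos_pi3 sin_pi3 mulr_natl cos_mulr2n sin_mulr2n cos2sin2; field.
Qed.

(** The left side is [(r - 1)^2 + 2 r (1 - c)], at most [1 / 100 + 11 / 565], which is below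
    [(4 / 23)^2]. *)
Lemma near_corner (R : realType) (r c : R) : 0 <= r <= 11 / 10 -> 1 <= r ->
  112 / 113 <= c -> r ^+ 2 - 2 * r * c + 1 < eta R ^+ 2.
Proof.
move=> r_le r_ge c_ge; have e_gt := eta_gt R.
apply: (@lt_trans _ _ ((4 / 23) ^+ 2)); last by rewrite ltrXn2r //; lra.
have : (r - 1) ^+ 2 <= (1 / 10) ^+ 2 by rewrite lerXn2r ?nnegrE //; lra.
have : 0 <= r * (c - 112 / 113) by rewrite mulr_ge0 //; lra.
by move=> *; lra.
Qed.

Lemma circle_lb (R : realFieldType) (C Y c y : R) : 0 <= Y <= y -> 0 <= C ->
  C ^+ 2 + Y ^+ 2 = 1 -> 0 <= c -> c ^+ 2 + y ^+ 2 <= 1 -> c <= C.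
Proof.
move=> /andP[Y0 Yy] C0 CY c0 cy; rewrite -(@ler_pXn2r _ 2) ?nnegrE //.
have : Y ^+ 2 <= y ^+ 2 by rewrite ler_pXn2r ?nnegrE //; lra.
by move: (Y ^+ 2) (y ^+ 2) (C ^+ 2) (c ^+ 2) CY cy => *; lra.
Qed.

(* One round of bootstrapping an upper bound for [Y]: a bound for [Y] bounds [C]
   from below on the unit circle, which improves the bound for [Y]. *)
Lemma chord_step (R : realFieldType) (q C Y b c y y' : R) :
  19 / 11 <= q -> 0 <= Y <= y -> 0 <= C -> C ^+ 2 + Y ^+ 2 = 1 ->
  Y * (q * C - Y) <= b -> 0 <= c -> c ^+ 2 + y ^+ 2 <= 1 ->
  0 < 19 / 11 * c - y -> b <= (19 / 11 * c - y) * y' -> 0 <= Y <= y'.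
Proof.
move=> q_ge Yy C0 CY Yb c0 cy m0 by'; have cC := circle_lb Yy C0 CY c0 cy.
have /andP[Y0 Yley] := Yy; rewrite Y0 -(ler_pM2l m0) /=.
apply: le_trans by'; apply: le_trans Yb; rewrite mulrC ler_wpM2l //.
have : 19 / 11 * c <= q * C by rewrite ler_pM //; lra.
by move: (q * C) => *; lra.
Qed.

(** Outside [W1] the bound on [r] limits the excess of [t] over [1 / 2], hence [sin d], until
    [near_corner] applies. *)
Lemma corner_W1 (R : realType) (r d : R) : 0 <= r <= 11 / 10 -> 0 <= d <= pi / 6 ->
  Defs.sfun (cos (pi / 3 - 2 * d)) <= r ^+ 2 ->
  r ^+ 2 - 2 * r * cos d + 1 < eta R ^+ 2.
Proof.
move=> r_le d6; have [Y0 Y1 C0 tE] := sin_cos_sector d6.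
have /cos2_sector : - (pi / 6) <= pi / 6 - d <= pi / 6 by lra.
rewrite (_ : 2 * _ = pi / 3 - 2 * d); last by field.
move=> t12 /(ge_sfun t12)[]; rewrite tE.
have CY := cos2Dsin2 d; have /andP[q_ge _] := sqrt3_itv R => s1 fs.
have s_le : r ^+ 2 <= 121 / 100.
  apply: (@le_trans _ _ ((11 / 10) ^+ 2)); last by lra.
  by rewrite lerXn2r ?nnegrE //; lra.
have r1 : 1 <= r by rewrite -(@ler_pXn2r _ 2) ?nnegrE ?expr1n //; lra.
apply: near_corner => //.
(* With [s = r^2] and excess [Z], the inequality [fs] says [2 Z s^2 <= (s - 1) (s^2 + 1)]; [8 / 45]
   is just above the resulting bound at [s = 121 / 100]. *)
have t_le : sin d * (Num.sqrt 3 * cos d - sin d) <= 8 / 45.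
  move: (sin d * (Num.sqrt 3 * cos d - sin d)) (r ^+ 2) s1 s_le fs => Z s s1 s_le fs.
  (* An approximate factorization of [(16 / 45) s^2 - (s - 1) (s^2 + 1)], which has a root just
     above [121 / 100]; the remainder is positive. *)
  have prod_ge0 : 0 <= (121 / 100 - s) * (s * (s - 1 / 7) + 19 / 23).
    apply: mulr_ge0; first by lra.
    by apply: addr_ge0; [apply: mulr_ge0; lra | lra].
  have s2 : 0 < s ^+ 2 by apply: exprn_gt0; exact: lt_le_trans s1.
  have sqr1_ge0 : 0 <= (s - 1) ^+ 2 by exact: sqr_ge0.
  by rewrite -(ler_pM2r s2); lra.
have Y2 : 0 <= sin d <= 2 / 11.
  by apply: (@chord_step R _ _ _ _ (6 / 7) (1 / 2) _ q_ge _ C0 CY t_le); lra.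
have Y3 : 0 <= sin d <= 2 / 17.
  by apply: (@chord_step R _ _ _ _ (57 / 58) (2 / 11) _ q_ge _ C0 CY t_le); lra.
by apply: circle_lb Y3 C0 CY _ _; lra.
Qed.

(** The argument of [corner_W1] with [r^4] for [r^2] and [2 d] for [d]. *)
Lemma corner_W2 (R : realType) (r d : R) : 0 <= r <= 11 / 10 -> 0 <= d <= pi / 12 ->
  Defs.sfun (cos (pi / 3 - 4 * d)) <= r ^+ 4 ->
  r ^+ 2 - 2 * r * cos d + 1 < eta R ^+ 2.
Proof.
move=> r_le d12; have d6 : 0 <= 2 * d <= pi / 6 by lra.
have [Y0 Y1 C0 tE] := sin_cos_sector d6.
have /cos2_sector : - (pi / 6) <= pi / 6 - 2 * d <= pi / 6 by lra.
rewrite (_ : 2 * _ = pi / 3 - 2 * (2 * d)); last by field.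
rewrite (_ : 4 * d = 2 * (2 * d)); last by ring.
move=> t12 /(ge_sfun t12)[]; rewrite tE.
have CY := cos2Dsin2 (2 * d); have /andP[q_ge _] := sqrt3_itv R => s1 fs.
have s_le : r ^+ 4 <= 22 / 15.
  apply: (@le_trans _ _ ((11 / 10) ^+ 4)); last by lra.
  by rewrite lerXn2r ?nnegrE //; lra.
have r1 : 1 <= r by rewrite -(@ler_pXn2r _ 4) ?nnegrE ?expr1n //; lra.
apply: near_corner => //.
have t_le : sin (2 * d) * (Num.sqrt 3 * cos (2 * d) - sin (2 * d)) <= 13 / 38.
  move: (sin (2 * d) * (Num.sqrt 3 * cos (2 * d) - sin (2 * d))) (r ^+ 4) s1 s_le fs => Z s s1 s_le fs.
  have prod_ge0 : 0 <= (22 / 15 - s) * (s * (s - 3 / 14) + 17 / 25).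
    apply: mulr_ge0; first by lra.
    by apply: addr_ge0; [apply: mulr_ge0; lra | lra].
  have s2 : 0 < s ^+ 2 by apply: exprn_gt0; exact: lt_le_trans s1.
  have sqr1_ge0 : 0 <= (s - 1) ^+ 2 by exact: sqr_ge0.
  by rewrite -(ler_pM2r s2); lra.
have Y2 : 0 <= sin (2 * d) <= 7 / 20.
  by apply: (@chord_step R _ _ _ _ (6 / 7) (1 / 2) _ q_ge _ C0 CY t_le); lra.
have Y3 : 0 <= sin (2 * d) <= 3 / 11.
  by apply: (@chord_step R _ _ _ _ (14 / 15) (7 / 20) _ q_ge _ C0 CY t_le); lra.
have Y4 : 0 <= sin (2 * d) <= 1 / 4.
  by apply: (@chord_step R _ _ _ _ (25 / 26) (3 / 11) _ q_ge _ C0 CY t_le); lra.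
have C4 : 30 / 31 <= cos (2 * d) by apply: circle_lb Y4 C0 CY _ _; lra.
have cd0 : 0 <= cos d by have pi0 := pi_gt0 R; apply: cos_ge0_pihalf; lra.
(* By the half-angle formula [cos d ^+ 2 >= 61 / 62], above [(112 / 113)^2]. *)
rewrite -(@ler_pXn2r _ 2) ?nnegrE //.
have cos2E : cos (2 * d) = 2 * cos d ^+ 2 - 1 by rewrite mulr_natl cos_mulr2n; ring.
by move: C4; rewrite cos2E; lra.
Qed.

(** * Rotations of [W] and the two inclusions *)

Lemma W_muli (R : realType) (z : R[i]) : @W R ('i%C * z) -> @W R z.
Proof.
have i0 : ('i%C : R[i]) != 0 by rewrite eq_complex /= oner_eq0 andbF.
move=> [m /= m3 [y Uy yz]]; case: m m3 yz => [_|m m3] yz.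
  (* The index 0 wraps around to 3, as [i^4 = 1]. *)
  exists 3%N => //; exists y => //; apply: (mulfI i0); rewrite -yz expr0 mul1r mulrA.
  by rewrite -exprS (exprM _ 2 2) sqr_i sqrrN expr1n mul1r.
exists m; first exact: ltnW.
by exists y => //; apply: (mulfI i0); rewrite -yz mulrA -exprS.
Qed.

Lemma W_subset_interior (R : realType) : @W R `<=` interior (@Sigma_pi R).
Proof.
move=> _ [m _ [y Uy <-]]; apply: interior_bloch_Sigma_pi.
suff yI : interior (closure (@bloch R : set R[i]^o)) y.
  elim: m => [|m IH]; first by rewrite expr0 mul1r.
  by rewrite exprS -mulrA; exact: interior_bloch_muli.
have sin6 : sin (pi / 6) ^+ 2 = 1 / 4 :> R by rewrite sin_pi6; field.
case: Uy => [[[]|]|]; first exact: W1_interior.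
- exact: W2_interior.
- by apply: eta_disc_interior => //; exact: cos_pi6.
- by apply: eta_disc_interior; rewrite ?cosN ?sinN ?sqrrN //; exact: cos_pi6.
Qed.

Lemma eta_disc_polar (R : realType) (r x a : R) :
  r ^+ 2 - 2 * r * cos (x - a) + 1 < eta R ^+ 2 ->
  eta_disc (expi a) (r%:C * expi x).
Proof.
rewrite -normc_expi_dist => lt_eta; have [eta0 _] := etaP R.
have etaC0 : (eta R)%:C != 0 :> R[i].
  by apply/eqP => /(congr1 (@complex.Re R)) /= e0; move: eta0; rewrite e0 ltxx.
exists ((r%:C * expi x - expi a) / (eta R)%:C).
  rewrite -[unit_disc _]/(is_true (Normc.normc _ < 1)) Normc.normcM Normc.normcV normc_real ?ltW //.
  by rewrite ltr_pdivrMr // mul1r -(@ltr_pXn2r _ 2) ?nnegrE ?normc_ge0 ?ltW.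
by rewrite mulrCA divff // mulr1 addrC subrK.
Qed.

Lemma sector1_subset (R : realType) (r x : R) :
  0 <= r <= 11 / 10 -> - (pi / 6) <= x <= pi / 6 ->
  [\/ @W1 R (r%:C * expi x), eta_disc (expi (pi / 6)) (r%:C * expi x)
    | eta_disc (expi (- (pi / 6))) (r%:C * expi x)].
Proof.
move=> r_le x6; have [rS|Sr] := ltP r (Sfun x).
  by apply: Or31; exists r, x; split=> //; rewrite rS andbT; lra.
have {Sr} sr : Defs.sfun (cos (2 * x)) <= r ^+ 2.
  have [s0 _ _] := sfunP (cos (2 * x)).
  by rewrite -(sqr_sqrtr (ltW s0)) lerXn2r ?nnegrE ?sqrtr_ge0 //; lra.
have [x0|/ltW x0] := leP 0 x.
  apply: Or32; apply: eta_disc_polar; rewrite -cosN opprB; apply: corner_W1 => //.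
    by lra.
  by rewrite (_ : pi / 3 - _ = 2 * x) //; field.
apply: Or33; apply: eta_disc_polar; rewrite opprK (addrC x); apply: corner_W1 => //.
  by lra.
by rewrite (_ : pi / 3 - _ = - (2 * x)) ?cosN //; field.
Qed.

(** The corner at angle [pi / 3] is [i] times the centre at [- pi / 6], hence the rotated point in
    the last case. The bisector [pi / 4] decides which corner is nearer. *)
Lemma sector2_subset (R : realType) (r x : R) :
  0 <= r <= 11 / 10 -> pi / 6 <= x <= pi / 3 ->
  [\/ @W2 R (r%:C * expi x), eta_disc (expi (pi / 6)) (r%:C * expi x)
    | eta_disc (expi (- (pi / 6))) (r%:C * expi (x - pi / 2))].
Proof.
move=> r_le x36; have [rS|Sr] := ltP r (Num.sqrt (Sfun (2 * x - pi / 2))).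
  by apply: Or31; exists r, x; split=> //; rewrite rS andbT; lra.
move: Sr; rewrite /Sfun (_ : 2 * (2 * x - pi / 2) = 4 * x - pi); last by field.
move=> Sr; have {Sr} sr : Defs.sfun (cos (4 * x - pi)) <= r ^+ 4.
  have [s0 _ _] := sfunP (cos (4 * x - pi)).
  rewrite -(sqr_sqrtr (ltW s0)) -[Num.sqrt (Defs.sfun _)]sqr_sqrtr ?sqrtr_ge0 //.
  by rewrite -exprM lerXn2r ?nnegrE ?sqrtr_ge0 //; lra.
have [x4|/ltW x4] := leP x (pi / 4).
  apply: Or32; apply: eta_disc_polar; apply: corner_W2 => //; first by lra.
  by rewrite (_ : pi / 3 - _ = - (4 * x - pi)) ?cosN //; field.
apply: Or33; apply: eta_disc_polar.
rewrite -cosN (_ : - (x - _ - _) = pi / 3 - x); last by field.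
apply: corner_W2 => //; first by lra.
by rewrite (_ : pi / 3 - _ = 4 * x - pi) //; field.
Qed.

(** In the first quadrant, angles up to [pi / 3] fall under the two sector lemmas; those from
    [pi / 3] to [pi / 2] are first turned by [- pi / 2] into the first sector. *)
Lemma disc_subset_W (R : realType) (z : R[i]) :
  Normc.normc z <= 11 / 10 -> @W R z.
Proof.
have inW y : @W1 R y \/ @W2 R y \/ @eta_disc R (expi (pi / 6)) y \/
    @eta_disc R (expi (- (pi / 6))) y -> @W R y.
  move=> Wy; exists 0%N => //; exists y; last by rewrite expr0 mul1r.
  by move: Wy => [|[|[|]]] ?; [left; left; left|left; left; right|left; right|right].
have inWi y : @W R (- 'i%C * y) -> @W R y.
  move=> Wy; do 3!apply: W_muli.
  suff -> : 'i%C * ('i%C * ('i%C * y)) = - 'i%C * y by [].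
  by rewrite !mulrA -expr2 sqr_i mulN1r.
elim/quadrant_ind: z => [z IH zr|z Rez Imz zr].
  by apply: W_muli; apply: IH; rewrite Normc.normcM normc_i mul1r.
have [x /andP[x0 x2] ->] := quadrant1_polar Rez Imz.
set r := Normc.normc z in zr *; have {zr} r_le : 0 <= r <= 11 / 10 by rewrite normc_ge0.
have rot : - 'i%C * (r%:C * expi x) = r%:C * expi (x - pi / 2).
  rewrite mulrCA expiD (mulrC (expi x)); congr (_ * (_ * _)).
  by rewrite expiN expi_pihalf; apply/eqP; rewrite eq_complex /= oppr0 !eqxx.
have [x6|/ltW x6] := leP x (pi / 6).
  have x66 : - (pi / 6) <= x <= pi / 6 by lra.
  by case: (sector1_subset r_le x66) => h; apply: inW; tauto.
have [x3|/ltW x3] := leP x (pi / 3).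
  have x63 : pi / 6 <= x <= pi / 3 by rewrite x6 x3.
  case: (sector2_subset r_le x63) => h; [by apply: inW; tauto | by apply: inW; tauto | apply: inWi].
  by rewrite rot; apply: inW; tauto.
have x66 : - (pi / 6) <= x - pi / 2 <= pi / 6 by lra.
by apply: inWi; rewrite rot; case: (sector1_subset r_le x66) => h; apply: inW; tauto.
Qed.

Unset Implicit Arguments.

Theorem proposition3p13 (R : realType) :
  [set (11 / 10 : R)%:C * z | z in closure (@unit_disc R)] `<=` @W R /\
  @W R `<=` interior (@Sigma_pi R).
Proof.
split; last exact: W_subset_interior.
move=> _ [z /closure_normcP z_cl <-]; apply: disc_subset_W.
rewrite Normc.normcM normc_real; last by lra.
suff z1 : Normc.normc z <= 1 by lra.
apply/ler_addgt0Pr => e e0; have [w w1 wz] := z_cl e e0.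
rewrite -(subrK w z); apply: (le_trans (le_normcD _ _)).
by rewrite addrC lerD ?ltW // -normcN opprB.
Qed.
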